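(* For every real number $c > 1$, there is a graph $G$ for which $\alpha_1(G) + c\,\tau_1(G) > |E(G)|$.
   Context: Graphs are finite and simple. $V(G)$ and $E(G)$ denote the vertex set and edge set of $G$. A triangle independent set in a graph $G$ is a set of edges of $G$ containing at most one edge from each triangle of $G$; $\alpha_1(G)$ denotes the size of a largest triangle independent set in $G$. A triangle edge cover in $G$ is a set of edges of $G$ containing at least one edge from each triangle of $G$ (equivalently, a set of edges whose deletion makes $G$ triangle-free); $\tau_1(G)$ denotes the size of a smallest triangle edge cover in $G$. *)

(* Defs.v *)
From HB Require Import structures.
From mathcomp Require Import all_boot all_order all_algebra.
From mathcomp Require Import reals.
Set Implicit Arguments.
Unset Strict Implicit.
Unset Printing Implicit Defensive.

Record sgraph := SGraph {
  vertex :> finType;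
  adj : rel vertex;
  adj_sym : symmetric adj;
  adj_irrefl : irreflexive adj
}.

(* Edges are two-element vertex sets, so each edge is counted once. *)
Definition edges (G : sgraph) : {set {set G}} :=
  [set [set p.1; p.2] | p : G * G & adj p.1 p.2].

(* A triangle is encoded by its set of three vertices. *)
Definition triangle (G : sgraph) (t : {set G}) : bool :=
  (#|t| == 3) && [forall x in t, forall y in t, (x != y) ==> adj x y].

Definition triangle_edges (G : sgraph) (t : {set G}) : {set {set G}} :=
  [set e in edges G | e \subset t].

Definition triangle_independent (G : sgraph) (A : {set {set G}}) : bool :=
  (A \subset edges G) &&
  [forall (t : {set G} | triangle t), #|A :&: triangle_edges t| <= 1].

Definition triangle_edge_cover (G : sgraph) (A : {set {set G}}) : bool :=
  (A \subset edges G) &&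
  [forall (t : {set G} | triangle t), 1 <= #|A :&: triangle_edges t|].

Definition alpha1 (G : sgraph) : nat :=
  \max_(A : {set {set G}} | triangle_independent A) #|A|.

(* The default [edges G] is itself a cover ([edges_cover] below), so the
   minimum is a genuine one. *)
Definition tau1 (G : sgraph) : nat :=
  #|[arg min_(A < edges G | triangle_edge_cover A) #|A|]|.

Lemma edges_cover (G : sgraph) : triangle_edge_cover (edges G).
Proof.
rewrite /triangle_edge_cover subxx /=; apply/forall_inP => t /andP[t3 /forall_inP Ht].
have /card_gt1P[x [y [xt yt xy]]] : 1 < #|t| by rewrite (eqP t3).
apply/card_gt0P; exists [set x; y].
have exy : [set x; y] \in edges G.
  apply/imsetP; exists (x, y) => //=; rewrite inE /=.
  exact: (implyP (forall_inP (Ht x xt) y yt)).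
by rewrite !inE exy /= subUset !sub1set xt yt.
Qed.

Lemma tau1_min (G : sgraph) (A : {set {set G}}) :
  triangle_edge_cover A -> tau1 G <= #|A|.
Proof. by rewrite /tau1; case: arg_minnP => [|B _ minB /minB//]; apply: edges_cover. Qed.

Lemma tau1_attained (G : sgraph) :
  exists2 A : {set {set G}}, triangle_edge_cover A & #|A| = tau1 G.
Proof. by rewrite /tau1; case: arg_minnP => [|B ? _]; [apply: edges_cover | exists B]. Qed.

Lemma alpha1_max (G : sgraph) (A : {set {set G}}) :
  triangle_independent A -> #|A| <= alpha1 G.
Proof. by move=> indA; apply: (leq_bigmax_cond A). Qed.

Lemma alpha1_attained (G : sgraph) :
  exists2 A : {set {set G}}, triangle_independent A & #|A| = alpha1 G.
Proof.
have ind0 : triangle_independent (set0 : {set {set G}}).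
  rewrite /triangle_independent sub0set; apply/forall_inP => t _.
  by rewrite set0I cards0.
have [|A indA eqA] := @eq_bigmax_cond _ (@triangle_independent G) (fun A => #|A|).
  by apply/card_gt0P; exists set0.
by exists A.
Qed.

(* Main.v *)
Require Import Defs.
From mathcomp Require Import all_boot all_order all_algebra.
From mathcomp Require Import reals.
From mathcomp Require Import ring lra.
Import Order.TTheory GRing.Theory Num.Theory.
Local Open Scope ring_scope.

Set Implicit Arguments.
Unset Strict Implicit.
Unset Printing Implicit Defensive.

(** Take a triangle-free graph H on n vertices whose stable sets all have at
    most n / K vertices, and let G be the cone over H: a new vertex, the apex,
    joined to every vertex of H.  Each triangle of G consists of the apex and an
    edge of H, so E(H) is triangle independent and alpha_1(G) >= |E(G)| - n.
    Picking a vertex of H in each edge of a triangle edge cover of G gives a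
    vertex cover of H ([tau1_cone]), whose complement is stable, so
    tau_1(G) >= n - n / K.  Hence
      alpha_1(G) + c tau_1(G) >= |E(G)| - n + c (1 - 1 / K) n,
    which exceeds |E(G)| as soon as K > c / (c - 1).

    Graphs H exist because Mycielski's construction preserves
    triangle-freeness and, by a theorem of Larsen, Propp and Ullman, turns the
    fractional chromatic number r into r + 1 / r, so that r ^ 2 grows by at
    least 2.  A vertex weighting of total r under which every stable set weighs
    at most 1 is the dual side of the linear programme that defines r; taking it
    rational, clearing denominators and replacing each vertex by
    as many copies as its weight gives a graph in which stable sets have at
    most a proportion 1 / r of the vertices ([triangle_free_small_stable]).

    The recursion for the weighting needs both sides of that linear programme.
    The primal side is carried in a form that mentions no fractional colouring:
    for every nonnegative f on the vertices, some stable set captures at least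
    a proportion 1 / r of the total of f.  See [mycielskian_certificate]. *)

Definition triangle_free (G : sgraph) : Prop :=
  forall x y z : G, adj x y -> adj x z -> adj y z -> False.

Definition stable (G : sgraph) (S : {set G}) : Prop :=
  {in S &, forall x y, ~~ adj x y}.

Lemma edgeP (G : sgraph) (e : {set G}) :
  reflect (exists2 p : G * G, adj p.1 p.2 & e = [set p.1; p.2]) (e \in edges G).
Proof.
by apply: (iffP imsetP) => -[p Hp ->]; exists p; rewrite ?inE in Hp *.
Qed.

Lemma triangle_adj (G : sgraph) (t : {set G}) x y :
  triangle t -> x \in t -> y \in t -> x != y -> adj x y.
Proof.
move=> /andP[_ /forall_inP Ht] xt yt; apply/implyP.
exact: (forall_inP (Ht x xt)).
Qed.

(** * Cones *)

Section Cone.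

Variable G : sgraph.

Definition cone_adj (x y : option G) : bool :=
  match x, y with
  | Some u, Some v => adj u v
  | None, None => false
  | _, _ => true
  end.

Lemma cone_adj_sym : symmetric cone_adj.
Proof. by case=> [u|] [v|] //=; apply: adj_sym. Qed.

Lemma cone_adj_irrefl : irreflexive cone_adj.
Proof. by case=> [u|] //=; apply: adj_irrefl. Qed.

Definition cone : sgraph := SGraph cone_adj_sym cone_adj_irrefl.

(** The edges of [G], seen in the cone; they will be the large triangle
    independent set. *)
Definition base_edges : {set {set cone}} :=
  [set [set Some x | x in e] | e : {set G} in edges G].

Lemma base_edgeP (e : {set cone}) :
  reflect (exists2 p : G * G, adj p.1 p.2 & e = [set Some p.1; Some p.2])
          (e \in base_edges).
Proof.
apply: (iffP imsetP) => [[f /imsetP[p Hp ->] ->]|[p Hp ->]].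
  by exists p; [rewrite inE in Hp | rewrite imsetU1 imset_set1].
exists [set p.1; p.2]; last by rewrite imsetU1 imset_set1.
by apply/imsetP; exists p; rewrite ?inE.
Qed.

Lemma card_edges_cone : (#|edges cone| <= #|base_edges| + #|G|)%N.
Proof.
pose spokes : {set {set cone}} := [set [set None; Some v] | v : G].
have sub : edges cone \subset base_edges :|: spokes.
  apply/subsetP => e /edgeP[[x y] /= xy ->]; rewrite inE.
  case: x y xy => [u|] [v|] //= uv; apply/orP.
  - by left; apply/base_edgeP; exists (u, v).
  - by right; apply/imsetP; exists u; rewrite // setUC.
  - by right; apply/imsetP; exists v.
apply: leq_trans (subset_leq_card sub) _.
apply: leq_trans (leq_card_setU _ _) _; rewrite leq_add2l.
by rewrite (leq_trans (leq_imset_card _ _)).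
Qed.

(** A triangle of the cone must contain the apex, and then the only base edge
    that it contains is the one opposite the apex. *)
Lemma triangle_free_base_independent :
  triangle_free G -> triangle_independent base_edges.
Proof.
move=> tfG; apply/andP; split.
  apply/subsetP => e /base_edgeP[p Hp ->].
  by apply/edgeP; exists (Some p.1, Some p.2).
apply/forall_inP => t tri.
have t3 : #|t| = 3 by case/andP: tri => /eqP.
have [Nt|Nt] := boolP (None \in t); last first.
  have [x [y [z [[xt yt zt] [xy yz zx]]]]] : exists x y z,
      [/\ x \in t, y \in t & z \in t] /\ [/\ x != y, y != z & z != x].
    by apply/card_gt2P; rewrite t3.
  have xy_adj := triangle_adj tri xt yt xy.
  have yz_adj := triangle_adj tri yt zt yz.
  have xz_adj : @adj cone x z by apply: (triangle_adj tri); rewrite // eq_sym.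
  case: x y z xt yt zt xy_adj yz_adj xz_adj {xy yz zx} => [x|] [y|] [z|];
    rewrite ?(negbTE Nt) //= => _ _ _ xy yz xz.
  by case: (tfG _ _ _ xy xz yz).
have eq_opp e : e \in base_edges :&: triangle_edges t -> e = t :\ None.
  rewrite !inE => /and3P[/base_edgeP[[u v] /= uv ->] _ sub].
  apply/eqP; rewrite eqEcard subsetD1 sub !inE /=.
  move: (cardsD1 None t); rewrite t3 Nt add1n => -[<-].
  by rewrite cards2; case: eqP uv => // -[->]; rewrite adj_irrefl.
by apply/card_le1_eqP => e f /eq_opp-> /eq_opp->.
Qed.

(** Choose a vertex of [G] in each edge of a cover [C].  The set [T] of the
    vertices never chosen is stable: if [u] and [v] in [T] were adjacent, then
    an edge of [C] in the triangle they span with the apex would have [u] or [v]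
    as its chosen vertex.  As [T] omits at most [#|C|] vertices, the bound
    follows. *)
Lemma tau1_cone (a : nat) :
  (forall S : {set G}, stable S -> (#|S| <= a)%N) -> (#|G| <= tau1 cone + a)%N.
Proof.
move=> stabG; have [C /andP[_ /forall_inP covC] <-] := tau1_attained cone.
pose f (e : {set cone}) : cone := [pick v | Some v \in e].
pose T := [set v : G | Some v \notin f @: C].
have TC : (#|~: T| <= #|C|)%N.
  rewrite -(card_imset (mem (~: T)) (@Some_inj _)).
  apply: leq_trans (leq_imset_card f C); apply: subset_leq_card.
  by apply/subsetP => _ /imsetP[v vT ->]; rewrite !inE negbK in vT.
have stabT : stable T.
  move=> u v; rewrite !inE => uT vT; apply/negP => uv.
  have uv' : u != v by apply: contraTneq uv => ->; rewrite adj_irrefl.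
  pose t : {set cone} := [set None; Some u; Some v].
  have tri : triangle t.
    apply/andP; split.
      by rewrite /t -setUA cardsU1 !inE cards2 (inj_eq Some_inj) uv'.
    apply/forall_inP => x xt; apply/forall_inP => y yt; apply/implyP.
    move: xt yt; rewrite !inE -!orbA.
    by move=> /or3P[]/eqP-> /or3P[]/eqP->; rewrite ?eqxx //= adj_sym.
  have /card_gt0P[e] := covC t tri.
  rewrite !inE => /and3P[eC /edgeP[[x y] /= xy e_xy] sub].
  have : f e \in f @: C by apply: imset_f.
  rewrite /f; case: pickP => [w we|no].
    move: (subsetP sub _ we); rewrite !inE /= => /orP[]/eqP[->].
      by rewrite (negbTE uT).
    by rewrite (negbTE vT).
  move: xy; rewrite e_xy in no.
  case: x y no {e_xy} => [x|] [y|] no //=.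
  - by move: (no x); rewrite !inE eqxx.
  - by move: (no x); rewrite !inE eqxx.
  - by move: (no y); rewrite !inE eqxx orbT.
by rewrite -(cardsC T) addnC leq_add // stabG.
Qed.

End Cone.

(** * Mycielskians and the fractional chromatic number *)

Lemma sum_option (R : nmodType) (T : finType) (P : pred (option T))
    (F : option T -> R) :
  \sum_(x | P x) F x =
    (if P None then F None else 0) + \sum_(x | P (Some x)) F (Some x).
Proof.
rewrite big_mkcond (bigD1 None) //=; congr (_ + _).
rewrite [RHS]big_mkcond /= (reindex_omap Some id) //=; last by case.
by apply: eq_bigl => x; rewrite eqxx.
Qed.

Section Mycielskian.

Variable G : sgraph.

(** [Some (inl u)] is the original vertex [u], [Some (inr u)] its shadow, and
    [None] the vertex joined to all shadows. *)
Definition myc_adj (x y : option (G + G)) : bool :=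
  match x, y with
  | Some (inl u), Some (inl v) => adj u v
  | Some (inl u), Some (inr v) => adj u v
  | Some (inr u), Some (inl v) => adj u v
  | Some (inr _), None => true
  | None, Some (inr _) => true
  | _, _ => false
  end.

Lemma myc_adj_sym : symmetric myc_adj.
Proof. by case=> [[u|u]|] [[v|v]|] //=; apply: adj_sym. Qed.

Lemma myc_adj_irrefl : irreflexive myc_adj.
Proof. by case=> [[u|u]|] //=; apply: adj_irrefl. Qed.

Definition mycielskian : sgraph := SGraph myc_adj_sym myc_adj_irrefl.

Lemma triangle_free_mycielskian : triangle_free G -> triangle_free mycielskian.
Proof.
by move=> tf [[x|x]|] [[y|y]|] [[z|z]|] //=; apply: tf.
Qed.

Lemma sum_mycielskian (R : nmodType) (P : pred mycielskian)
    (F : mycielskian -> R) :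
  \sum_(x | P x) F x =
    (if P None then F None else 0) +
    (\sum_(u | P (Some (inl u))) F (Some (inl u)) +
     \sum_(u | P (Some (inr u))) F (Some (inr u))).
Proof. by rewrite (sum_option P) big_sumType. Qed.

End Mycielskian.

(** The weighting [w] is a fractional clique of total [r].  The last field is
    fractional [r]-colourability in dual form: averaging [f] over a fractional
    colouring of total [r] produces the set [S], and linear programming duality
    gives the converse.  Together they certify that [r] is the fractional
    chromatic number. *)
Record fractional_chromatic_certificate (G : sgraph) (w : G -> rat) (r : rat) :
    Prop := FractionalChromaticCertificate {
  weight_ge0 : forall v, 0 <= w v;
  weight_total : \sum_v w v = r;
  weight_stable : forall S : {set G}, stable S -> \sum_(v in S) w v <= 1;
  stable_share : forall f : G -> rat, (forall v, 0 <= f v) ->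
    exists2 S : {set G}, stable S & \sum_v f v <= r * \sum_(v in S) f v
}.

Definition mycielskian_weight (G : sgraph) (w : G -> rat) (r : rat)
    (x : mycielskian G) : rat :=
  match x with
  | Some (inl u) => (1 - r^-1) * w u
  | Some (inr u) => r^-1 * w u
  | None => r^-1
  end.

(** Stable sets weigh at most 1: let a stable set contain the vertices of [S]
    and the shadows of [T].  If it contains the extra vertex, then [T] is empty
    and the weight is at most [(1 - 1/r) + 1/r].  Otherwise the union of [S] with
    any stable subset of [T :\: S] is stable, so those subsets weigh at most
    [1 - w(S)]; a share [1/r] of [T :\: S] is carried by one of them, so that
    [w(T) <= w(S) + r (1 - w(S))], and the whole weight is at most
    [(1 - 1/r) w(S) + w(T)/r <= 1].

    Shares: a fractional [r]-colouring of [G] extends to the Mycielskian by using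
    a colour class [S] partly as [S] with its shadows (proportion [1 - 1/r]) and
    partly as [S] with the extra vertex (proportion [1/r]), and by adding the
    class of all shadows with coefficient [1/r]; its total is
    [(r - 1) + 1 + 1/r].  These are the three candidates below, for a set [S]
    that takes a share of [f0 + (1 - 1/r) f1]. *)
Lemma mycielskian_certificate (G : sgraph) (w : G -> rat) (r : rat) :
  1 <= r -> fractional_chromatic_certificate w r ->
  fractional_chromatic_certificate (mycielskian_weight w r) (r + r^-1).
Proof.
move=> r1 [w_ge0 w_tot w_stab share].
have r0 : 0 < r by apply: lt_le_trans r1.
have rV0 : 0 < r^-1 by rewrite invr_gt0.
have rV1 : 0 <= 1 - r^-1 by rewrite subr_ge0 invf_le1.
have rrV : r * r^-1 = 1 by rewrite mulfV // gt_eqF.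
split.
- by case=> [[u|u]|] /=; rewrite ?mulr_ge0 // ltW.
- rewrite sum_mycielskian /= -!mulr_sumr w_tot; lra.
- move=> I stabI.
  rewrite (sum_mycielskian (mem I)) /= -!mulr_sumr.
  pose S := [set u : G | Some (inl u) \in I].
  pose T := [set u : G | Some (inr u) \in I].
  have -> : \sum_(u | Some (inl u) \in I) w u = \sum_(u in S) w u.
    by apply: eq_bigl => u; rewrite inE.
  have -> : \sum_(u | Some (inr u) \in I) w u = \sum_(u in T) w u.
    by apply: eq_bigl => u; rewrite inE.
  have stabS : stable S.
    by move=> u v; rewrite !inE => /stabI uI /uI.
  have S1 := w_stab S stabS.
  have [NI|NI] := boolP (None \in I).
    have -> : T = set0.
      by apply/setP => u; rewrite !inE; apply/negP => /(stabI _ _ NI).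
    rewrite big_set0; nra.
  have [J stabJ] : exists2 J : {set G}, stable J &
      \sum_(v in T :\: S) w v <= r * \sum_(v in J :&: (T :\: S)) w v.
    have [|J stabJ HJ] := share (fun v => if v \in T :\: S then w v else 0).
      by move=> v; case: ifP.
    exists J => //; rewrite big_mkcond.
    rewrite (eq_bigl _ _ (fun v => in_setI v J (T :\: S))) big_mkcondr.
    exact: HJ.
  set J' := J :&: (T :\: S) => HJ.
  have stabSJ : stable (S :|: J').
    move=> u v; rewrite !inE.
    move=> /orP[uS|/and3P[uJ uS uT]] /orP[vS|/and3P[vJ vS vT]].
    + exact: (stabI _ _ uS vS).
    + exact: (stabI _ _ uS vT).
    + exact: (stabI _ _ uT vS).
    + exact: stabJ.
  have SJ1 := w_stab _ stabSJ.
  have SJ : \sum_(v in S :|: J') w v = \sum_(v in S) w v + \sum_(v in J') w v.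
    have dis : [disjoint S & J'].
      by apply/pred0P => v; rewrite /= !inE; case: (_ \in I); rewrite ?andbF.
    by rewrite -bigU //; apply: eq_bigl => v; rewrite !inE.
  have TS : \sum_(v in T) w v <= \sum_(v in S) w v + \sum_(v in T :\: S) w v.
    rewrite (big_setID S) /= lerD2r [leRHS](big_setID T) /= setIC lerDl.
    exact: sumr_ge0.
  rewrite SJ in SJ1; rewrite add0r.
  set s := \sum_(v in S) w v in S1 SJ1 TS *.
  set j := \sum_(v in J') w v in SJ1 HJ *.
  set t := \sum_(v in T) w v in TS *.
  have : r^-1 * t <= r^-1 * (s + r * j).
    by rewrite ler_pM2l //; lra.
  have : r^-1 * (s + r * j) = r^-1 * s + j.
      by rewrite mulrDr mulrA mulVf ?mul1r ?gt_eqF.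
  lra.
- move=> f f_ge0.
  pose f0 u := f (Some (inl u)); pose f1 u := f (Some (inr u)).
  have [|S stabS HS] := share (fun u => f0 u + (1 - r^-1) * f1 u).
    by move=> u; rewrite addr_ge0 ?mulr_ge0 ?f_ge0.
  pose I0 : {set mycielskian G} := [set x | match x with
    | Some (inl u) | Some (inr u) => u \in S | None => false end].
  pose I1 : {set mycielskian G} := [set x | match x with
    | Some (inl u) => u \in S | Some (inr u) => false | None => true end].
  pose I2 : {set mycielskian G} := [set x | match x with
    | Some (inr u) => true | _ => false end].
  have stab0 : stable I0.
    by case=> [[u|u]|] [[v|v]|]; rewrite !inE //; apply: stabS.
  have stab1 : stable I1.
    by case=> [[u|u]|] [[v|v]|]; rewrite !inE //; apply: stabS.
  have stab2 : stable I2.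
    by case=> [[u|u]|] [[v|v]|]; rewrite !inE //; apply: stabS.
  rewrite !big_split /= -!mulr_sumr in HS.
  have sum0 : \sum_(x in I0) f x = \sum_(u in S) f0 u + \sum_(u in S) f1 u.
    rewrite (sum_mycielskian (mem I0)) /= inE add0r.
    by congr (_ + _); apply: eq_bigl => u; rewrite inE.
  have sum1 : \sum_(x in I1) f x = f None + \sum_(u in S) f0 u.
    rewrite (sum_mycielskian (mem I1)) /= inE; congr (_ + _).
    rewrite [X in _ + X]big1 ?addr0 => [|u]; last by rewrite inE.
    by apply: eq_bigl => u; rewrite inE.
  have sum2 : \sum_(x in I2) f x = \sum_u f1 u.
    rewrite (sum_mycielskian (mem I2)) /= inE add0r.
    rewrite [X in X + _]big1 ?add0r => [|u]; last by rewrite inE.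
    by apply: eq_bigl => u; rewrite inE.
  (* The coefficients sum to [r + r^-1], so the best candidate has its share. *)
  have mean : \sum_x f x <= (r - 1) * \sum_(x in I0) f x + \sum_(x in I1) f x
                            + r^-1 * \sum_(x in I2) f x.
    rewrite sum0 sum1 sum2 sum_mycielskian /=.
    move: HS.
    set a := \sum_v f0 v; set b := \sum_v f1 v.
    set a' := \sum_(v in S) f0 v; set b' := \sum_(v in S) f1 v => HS.
    have E : r * (a' + (1 - r^-1) * b') = r * a' + (r - r * r^-1) * b' by ring.
    rewrite rrV in E.
    change (f None + (a + b) <=
            (r - 1) * (a' + b') + (f None + a') + r^-1 * b).
    lra.
  pose m := Num.max (Num.max (\sum_(x in I0) f x) (\sum_(x in I1) f x))
                    (\sum_(x in I2) f x).
  have [I stabI Im] :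
      exists2 I : {set mycielskian G}, stable I & \sum_(x in I) f x = m.
    rewrite /m; case: leP => _; first by exists I2.
    by case: leP => _; [exists I1 | exists I0].
  exists I => //; rewrite Im; apply: le_trans mean _.
  have m0 : \sum_(x in I0) f x <= m by rewrite /m !le_max lexx.
  have m1 : \sum_(x in I1) f x <= m by rewrite /m !le_max lexx orbT.
  have m2 : \sum_(x in I2) f x <= m by rewrite /m !le_max lexx !orbT.
  have h0 : (r - 1) * \sum_(x in I0) f x <= (r - 1) * m.
    by rewrite ler_wpM2l ?subr_ge0.
  have h2 : r^-1 * \sum_(x in I2) f x <= r^-1 * m by rewrite ler_pM2l.
  lra.
Qed.

(** Starting from one vertex, with [r = 1], each step adds
    [2 + r^-2] to [r ^+ 2]. *)
Lemma fractional_chromatic_unbounded (k : nat) :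
  exists (G : sgraph) (w : G -> rat) (r : rat),
    [/\ triangle_free G, fractional_chromatic_certificate w r, 1 <= r
      & k%:R <= r ^+ 2].
Proof.
elim: k => [|k [G [w [r [tfG cert r1 rk]]]]].
  have sym : symmetric (fun _ _ : unit => false) by [].
  have irr : irreflexive (fun _ _ : unit => false) by [].
  exists (SGraph sym irr), (fun _ => 1), 1; split=> //; split=> //.
  - by rewrite sumr_const /= card_unit.
  - move=> S _; rewrite sumr_const /= lern1.
    by rewrite (leq_trans (max_card _)) // card_unit.
  - move=> f _; exists setT => //.
    by rewrite mul1r; rewrite [leRHS](eq_bigl xpredT) // => x; rewrite inE.
exists (mycielskian G), (mycielskian_weight w r), (r + r^-1); split.
- exact: triangle_free_mycielskian.
- exact: mycielskian_certificate.
- have : 0 < r^-1 by rewrite invr_gt0 (lt_le_trans ltr01).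
  lra.
- have r0 : r != 0 by rewrite gt_eqF // (lt_le_trans ltr01).
  have := sqr_ge0 r^-1.
  have -> : (r + r^-1) ^+ 2 = r ^+ 2 + 2 + r^-1 ^+ 2 by field.
  rewrite -natr1; lra.
Qed.

(** * Blow-ups: from weights to cardinalities *)

Section Blowup.

Variables (G : sgraph) (m : G -> nat).

Definition blowup_adj : rel {v : G & 'I_(m v)} :=
  fun x y => adj (tag x) (tag y).

Lemma blowup_adj_sym : symmetric blowup_adj.
Proof. by move=> x y; apply: adj_sym. Qed.

Lemma blowup_adj_irrefl : irreflexive blowup_adj.
Proof. by move=> x; apply: adj_irrefl. Qed.

Definition blowup : sgraph := SGraph blowup_adj_sym blowup_adj_irrefl.

Lemma triangle_free_blowup : triangle_free G -> triangle_free blowup.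
Proof. by move=> tf x y z; apply: tf. Qed.

Lemma card_tag_preim (P : pred G) :
  #|[set x : blowup | P (tag x)]| = (\sum_(v | P v) m v)%N.
Proof.
under [RHS]eq_bigr => v _ do rewrite -(card_ord (m v)) -sum1_card.
rewrite (sig_big_dep _ _ (fun _ _ => 1%N)) /= -sum1_card.
by apply: eq_bigl => x; rewrite inE andbT.
Qed.

(** The projection of a stable set is stable, and a set has at most as many
    elements as the fibres that it meets. *)
Lemma stable_blowup (S : {set blowup}) :
  stable S -> exists2 T : {set G}, stable T & (#|S| <= \sum_(v in T) m v)%N.
Proof.
move=> stabS; exists [set tag x | x in S].
  by move=> _ _ /imsetP[x xS ->] /imsetP[y yS ->]; apply: (stabS x y).
rewrite -card_tag_preim; apply/subset_leq_card/subsetP => x xS.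
by rewrite inE; apply: imset_f.
Qed.

End Blowup.

Lemma common_denominator (T : finType) (w : T -> rat) :
  (forall v, 0 <= w v) ->
  exists (N : nat) (m : T -> nat), (0 < N)%N /\ forall v, (m v)%:R = N%:R * w v.
Proof.
move=> w_ge0.
pose d v := `|denq (w v)|%N; pose n v := `|numq (w v)|%N.
exists (\prod_v d v)%N, (fun v => n v * \prod_(u | u != v) d u)%N; split.
  by rewrite prodn_gt0 // => v; rewrite absz_gt0 denq_neq0.
move=> v; rewrite [X in _ = X%:R * _](bigD1 v) //= !natrM mulrAC; congr (_ * _).
rewrite -[w v in RHS]divq_num_den /d /n !natr_absz.
rewrite !ger0_norm ?numq_ge0 // ?denq_ge0 //.
by rewrite mulrC mulfVK // intr_eq0 denq_neq0.
Qed.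

(** In the blow-up by [m = N w], stable sets have at most [N] vertices, out of
    [N r]. *)
Lemma triangle_free_small_stable (K : nat) :
  exists2 G : sgraph, triangle_free G &
    (0 < #|G|)%N /\ forall S : {set G}, stable S -> (#|S| * K <= #|G|)%N.
Proof.
have [G [w [r [tfG [w_ge0 w_tot w_stab _] r1 rK]]]] :=
  fractional_chromatic_unbounded (K ^ 2).
have Kr : K%:R <= r.
  by rewrite -(@ler_pXn2r _ 2) ?nnegrE ?ler0n ?(le_trans ler01) // -natrX.
have [N [m [N0 mE]]] := common_denominator w_ge0.
have sumE (P : pred G) : (\sum_(v | P v) m v)%N%:R = N%:R * \sum_(v | P v) w v.
  by rewrite natr_sum mulr_sumr; apply: eq_bigr.
have NQ0 : 0 < N%:R :> rat by rewrite ltr0n.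
have cardE : #|blowup m|%:R = N%:R * r.
  rewrite -w_tot -sumE -(card_tag_preim m) -cardsT.
  by congr (#|pred_of_set _|%:R); apply/setP => x; rewrite !inE.
exists (blowup m); first exact: triangle_free_blowup.
split; first by rewrite -(ltr_nat rat) cardE mulr_gt0 // (lt_le_trans ltr01).
move=> S /stable_blowup[T stabT ST].
rewrite -(ler_nat rat) natrM cardE ler_pM ?ler0n //.
apply: le_trans (_ : (\sum_(v in T) m v)%N%:R <= _); first by rewrite ler_nat.
by rewrite sumE ler_piMr ?w_stab // ltW.
Qed.

Theorem theorem2p1 (R : realType) (c : R) (hc : c > 1) :
  exists G : sgraph,
    (alpha1 G)%:R + c * (tau1 G)%:R > #|edges G|%:R :> R.
Proof.
pose K := Num.Def.archi_bound (c / (c - 1)).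
have c0 : 0 < c - 1 by rewrite subr_gt0.
have KE : c < K%:R * (c - 1).
  by rewrite -ltr_pdivrMr // archi_boundP // divr_ge0 ?ltW // (lt_trans ltr01).
have K0 : (0 < K)%N.
  rewrite lt0n; apply: contraTneq KE => ->.
  by rewrite mul0r -leNgt ltW // (lt_trans ltr01).
have [G tfG [G0 stabG]] := triangle_free_small_stable K.
exists (cone G).
have alphaE := alpha1_max (triangle_free_base_independent tfG).
have tauE : (#|G| <= tau1 (cone G) + #|G| %/ K)%N.
  by apply: tau1_cone => S /stabG; rewrite leq_divRL.
have edgesE := card_edges_cone G.
have divE := leq_divM #|G| K.
move: alphaE tauE edgesE divE; rewrite -!(ler_nat R) !natrD natrM.
have : 0 < #|G|%:R :> R by rewrite ltr0n.
have : 0 < K%:R :> R by rewrite ltr0n.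
move: #|G|%:R (#|G| %/ K)%:R K%:R KE (alpha1 _)%:R (tau1 _)%:R #|edges _|%:R
  #|base_edges G|%:R.
move=> n q k Kc a t e b k0 n0 ab nt eb qk.
have q_lt : c * q < (c - 1) * n.
  rewrite -(ltr_pM2l k0).
  have : c * (q * k) <= c * n by rewrite ler_pM2l // (lt_trans ltr01).
  have : c * n < k * (c - 1) * n by rewrite ltr_pM2r.
  lra.
have : c * n <= c * (t + q) by rewrite ler_pM2l // (lt_trans ltr01).
lra.
Qed.
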